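(* Let $G_S$ be a self-loop graph with $|S|\ge1$, let $\widetilde G$ be its Açıkmeşe lift, and let $\chi_t^{\widetilde G}$ be its equivariant heat character on $\mathbb{Z}_2=\{1,g\}$. For every $t>0$, $$\chi_t^{\widetilde G}(1)=\mathrm{Tr}(e^{-tM_{sym}})+\mathrm{Tr}(e^{-t\mathcal{L}(G_S)}),\qquad \chi_t^{\widetilde G}(g)=\mathrm{Tr}(e^{-tM_{sym}})-\mathrm{Tr}(e^{-t\mathcal{L}(G_S)}).$$ Consequently, $$\mathrm{Tr}(e^{-tM_{sym}})=\frac{\chi_t^{\widetilde G}(1)+\chi_t^{\widetilde G}(g)}2,\qquad \mathrm{Tr}(e^{-t\mathcal{L}(G_S)})=\frac{\chi_t^{\widetilde G}(1)-\chi_t^{\widetilde G}(g)}2.$$ Moreover, for every $t>0$, $-\chi_t^{\widetilde G}(1)\le\chi_t^{\widetilde G}(g)\le\chi_t^{\widetilde G}(1)$; equivalently, $\chi_t^{\widetilde G}(1)\pm\chi_t^{\widetilde G}(g)\ge0$.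
   Context: Let $G$ be a finite undirected simple graph with vertex set $V=\{1,\dots,N\}$ (possibly disconnected), and $S\subseteq V$. The self-loop graph $G_S$ is obtained from $G$ by attaching one loop at every vertex of $S$; $\sigma=|S|$. The loop vector $s\in\mathbb{R}^N$ is the indicator vector of $S$. $\mathcal{L}(G)=D(G)-A(G)$ is the ordinary Laplacian and $\mathcal{L}(G_S):=\mathcal{L}(G)+\mathrm{diag}(s)$. For $\sigma\ge1$, the Açıkmeşe lift $\widetilde G=(\widetilde V,\widetilde E)$ of $G_S$ is the simple graph on $\widetilde V=\{1,\dots,2N+1\}$ such that: for each edge $\{i,j\}$ of $G$, both $\{i,j\}$ and $\{i+N+1,j+N+1\}$ are edges of $\widetilde G$; for each $i\in S$, both $\{i,N+1\}$ and $\{N+1,i+N+1\}$ are edges; there are no other edges. $\mathcal{L}(\widetilde G)$ is the ordinary Laplacian of $\widetilde G$. The involution matrix $T$ is the $(2N+1)\times(2N+1)$ permutation matrix of the map swapping $i\leftrightarrow i+N+1$ ($1\le i\le N$) and fixing $N+1$. Let $\rho$ be the representation of $\mathbb{Z}_2=\{1,g\}$ on $\mathbb{R}^{\widetilde V}$ with $\rho(1)=I$, $\rho(g)=T$. The equivariant heat character is $\chi_t^{\widetilde G}(h)=\mathrm{Tr}(e^{-t\mathcal{L}(\widetilde G)}\rho(h))$ for $h\in\mathbb{Z}_2$, $t>0$. $M_{sym}=\begin{pmatrix}2\sigma&-\sqrt2\,s^\top\\ -\sqrt2\,s&\mathcal{L}(G_S)\end{pmatrix}\in\mathbb{R}^{(N+1)\times(N+1)}$.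 *)

(* Defs.v *)
From HB Require Import structures.
From mathcomp Require Import all_boot all_order all_algebra all_fingroup.
From mathcomp Require Import mxrepresentation.
From mathcomp Require Import all_classical all_reals all_analysis.
Import Order.TTheory GRing.Theory Num.Theory.
Import numFieldNormedType.Exports.

Set Implicit Arguments.
Unset Strict Implicit.
Unset Printing Implicit Defensive.

Local Open Scope ring_scope.

(* The limit is taken in the normed space 'M[R]_n. *)
Definition mexp (R : realType) (n : nat) (A : 'M[R]_n) : 'M[R]_n :=
  limn (series (fun k : nat => (k`!%:R : R)^-1 *: A ^+ k)).

Record sgraph (V : finType) := SGraph {
  adj :> rel V;
  adj_sym : symmetric adj;
  adj_irr : irreflexive adj }.

Definition adjacency_mx (R : realType) (n : nat) (G : sgraph 'I_n) : 'M[R]_n :=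
  \matrix_(i, j) (adj G i j)%:R.

Definition degree (V : finType) (G : sgraph V) (v : V) : nat :=
  #|[set w | adj G v w]%SET|.

Definition degree_mx (R : realType) (n : nat) (G : sgraph 'I_n) : 'M[R]_n :=
  diag_mx (\row_i (degree G i)%:R).

Definition laplacian (R : realType) (n : nat) (G : sgraph 'I_n) : 'M[R]_n :=
  degree_mx R G - adjacency_mx R G.

(* The self-loop graph G_S is represented by the pair of G and S. *)
Definition loop_vec (R : realType) (N : nat) (S : {set 'I_N}) : 'cV[R]_N :=
  \col_i (i \in S)%:R.

Definition loop_laplacian (R : realType) (N : nat) (G : sgraph 'I_N)
    (S : {set 'I_N}) : 'M[R]_N :=
  laplacian R G + diag_mx (loop_vec R S)^T.

(* With 0-based vertices i < N, the 2N+1 vertices of the lift are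
   lo i = i, mid = N and hi i = i + N + 1. *)
Definition lift_vertex (N : nat) := 'I_(N + (1 + N)).
Definition lo (N : nat) (i : 'I_N) : lift_vertex N := lshift (1 + N) i.
Definition mid (N : nat) : lift_vertex N := rshift N (lshift N ord0).
Definition hi (N : nat) (i : 'I_N) : lift_vertex N := rshift N (rshift 1 i).

Lemma lift_vertex_size (N : nat) : (N + (1 + N) = 2 * N + 1)%N.
Proof. by rewrite addnCA addnn -mul2n addnC. Qed.

Lemma val_lo (N : nat) (i : 'I_N) : lo i = i :> nat.
Proof. by []. Qed.

Lemma val_mid (N : nat) : mid N = N :> nat.
Proof. by rewrite /= addn0. Qed.

Lemma val_hi (N : nat) (i : 'I_N) : hi i = (i + N + 1)%N :> nat.
Proof. by rewrite /= addnCA add1n addn1 addnC. Qed.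

Definition lift_adj (N : nat) (G : sgraph 'I_N) (S : {set 'I_N}) :
    rel (lift_vertex N) := fun u v =>
  let edge x y := [set u; v]%SET == [set x; y]%SET in
  [exists i : 'I_N, exists j : 'I_N,
     adj G i j && (edge (lo i) (lo j) || edge (hi i) (hi j))]
  || [exists i in S, edge (lo i) (mid N) || edge (mid N) (hi i)].

Lemma lift_adj_sym (N : nat) (G : sgraph 'I_N) (S : {set 'I_N}) :
  symmetric (lift_adj G S).
Proof. by move=> u v; rewrite /lift_adj (finset.setUC [set u]%SET). Qed.

Lemma set2_diag (V : finType) (u x y : V) :
  [set u; u]%SET == [set x; y]%SET -> x = y.
Proof.
move=> /eqP E.
have: x \in [set u; u]%SET by rewrite E set21.
have: y \in [set u; u]%SET by rewrite E set22.
by rewrite !inE !orbb => /eqP-> /eqP->.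
Qed.

Lemma lift_adj_irr (N : nat) (G : sgraph 'I_N) (S : {set 'I_N}) :
  irreflexive (lift_adj G S).
Proof.
move=> u; apply/negP => /orP[/existsP[i /existsP[j /andP[Gij]]]|].
  case/orP => /set2_diag E.
    by move: Gij; rewrite (lshift_inj E) adj_irr.
  by move: Gij; rewrite (rshift_inj (rshift_inj E)) adj_irr.
case/existsP=> i /andP[_ /orP[] /set2_diag E].
  by move/eqP: E; rewrite eq_lrshift.
by move/rshift_inj/eqP: E; rewrite eq_lrshift.
Qed.

Definition acikmese_lift (N : nat) (G : sgraph 'I_N) (S : {set 'I_N}) :
    sgraph (lift_vertex N) :=
  SGraph (@lift_adj_sym N G S) (@lift_adj_irr N G S).

Definition lift_swap (N : nat) (u : lift_vertex N) : lift_vertex N :=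
  match fintype.split u with
  | inl i => hi i
  | inr w => match fintype.split w with inl _ => mid N | inr i => lo i end
  end.

Lemma swap_lo (N : nat) (i : 'I_N) : lift_swap (lo i) = hi i.
Proof. by rewrite /lift_swap /lo -[lshift _ _]/(unsplit (inl _)) fintype.unsplitK. Qed.

Lemma swap_mid (N : nat) : lift_swap (mid N) = mid N.
Proof.
rewrite /lift_swap /mid -[rshift _ _]/(unsplit (inr _)) fintype.unsplitK.
by rewrite -[lshift _ _]/(unsplit (inl _)) fintype.unsplitK.
Qed.

Lemma swap_hi (N : nat) (i : 'I_N) : lift_swap (hi i) = lo i.
Proof.
rewrite /lift_swap /hi -[rshift N _]/(unsplit (inr _)) fintype.unsplitK.
by rewrite -[rshift _ _]/(unsplit (inr _)) fintype.unsplitK.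
Qed.

Lemma lift_swapK (N : nat) : involutive (@lift_swap N).
Proof.
move=> u; rewrite -[u]fintype.splitK; case: (fintype.split u) => [i|w] /=.
  by rewrite swap_lo swap_hi.
rewrite -[w]fintype.splitK; case: (fintype.split w) => [c|i] /=.
  by rewrite [c]ord1 swap_mid swap_mid.
by rewrite swap_hi swap_lo.
Qed.

Definition involution_mx (R : realType) (N : nat) : 'M[R]_(N + (1 + N)) :=
  perm_mx (perm (inv_inj (@lift_swapK N))).

Lemma involution_mxK (R : realType) (N : nat) :
  involution_mx R N *m involution_mx R N = 1%:M.
Proof.
rewrite /involution_mx -perm_mxM -[RHS]perm_mx1; congr perm_mx.
by apply/permP => u; rewrite permM !permE /= lift_swapK.
Qed.

(* 'Z_2 is written additively as a ring, multiplicatively as a group: its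
   identity is 1%g (the ring zero) and its other element is the ring one. *)
Definition gen : 'Z_2 := 1%R.

Definition rho_fun (R : realType) (N : nat) (h : 'Z_2) : 'M[R]_(N + (1 + N)) :=
  if h == 1%g then 1%:M else involution_mx R N.

Lemma rho_repr (R : realType) (N : nat) :
  mx_repr [set: 'Z_2]%SET (@rho_fun R N).
Proof.
split=> [|x y _ _]; first by rewrite /rho_fun eqxx.
rewrite /rho_fun.
case: x => [[|[|//]] px]; case: y => [[|[|//]] py] /=;
  by rewrite ?mul1mx ?mulmx1 ?involution_mxK.
Qed.

Definition rho (R : realType) (N : nat) :
    mx_representation R [set: 'Z_2]%G (N + (1 + N)) :=
  MxRepresentation (@rho_repr R N).

Lemma rho1 (R : realType) (N : nat) : rho R N 1%g = 1%:M.
Proof. by []. Qed.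

Lemma rho_gen (R : realType) (N : nat) : rho R N gen = involution_mx R N.
Proof. by []. Qed.

Definition heat_char (R : realType) (N : nat) (G : sgraph 'I_N)
    (S : {set 'I_N}) (t : R) (h : 'Z_2) : R :=
  \tr (mexp (- t *: laplacian R (acikmese_lift G S)) *m rho R N h).

Definition Msym (R : realType) (N : nat) (G : sgraph 'I_N)
    (S : {set 'I_N}) : 'M[R]_(1 + N) :=
  block_mx (2 * #|S|%:R)%:M                (- Num.sqrt 2 *: (loop_vec R S)^T)
           (- Num.sqrt 2 *: loop_vec R S)   (loop_laplacian R G S).

(* Main.v *)
Require Import Defs.
From HB Require Import structures.
From mathcomp Require Import all_boot all_order all_algebra all_fingroup.
From mathcomp Require Import all_classical all_reals all_analysis.
From mathcomp Require Import lra.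

(** The swap T of the two copies of G commutes with the Laplacian Lt of the
    lift, so R^(2N+1) splits into the T-even and the T-odd vectors, both
    Lt-invariant.  In the orthonormal basis of the even part made of the middle
    vertex and the vectors (e_i + e_{i'}) / sqrt 2, Lt acts as Msym; in the
    basis (e_i - e_{i'}) / sqrt 2 of the odd part it acts as the Laplacian L of
    the self-loop graph.  With these bases as columns of matrices U and W this
    says Lt U = U Msym and Lt W = W L ([laplacian_even], [laplacian_odd]),
    while T U = U and T W = - W.

    An intertwining relation A U = U B passes to the exponentials
    ([mexp_intertwine]), and U^T U = 1, W^T W = 1, U U^T + W W^T = 1.  Hence
    the trace of exp(-t Lt) is the sum of the traces of its two compressions,
    exp(-t Msym) and exp(-t L), and composing with T changes the sign of the
    second one.  The formulas for the two traces follow by solving this system.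

    The inequalities say that both traces are nonnegative.  This holds for the
    exponential of any real symmetric matrix A, since exp A = (exp (A/2))^2 and
    exp (A/2) is symmetric, so that the trace of exp A is the sum of the squares
    of the entries of exp (A/2) ([trace_mexp_ge0]).  The doubling formula is
    obtained from its scalar case: the square of the m-th partial sum for A,
    minus the m-th partial sum for 2A, is a polynomial in A with nonnegative
    coefficients, so its entries are bounded by the value of that polynomial at
    a multiple of the norm of A, which tends to exp(x)^2 - exp(2x) = 0. *)

Import Order.TTheory GRing.Theory Num.Theory.
Import numFieldNormedType.Exports.

Set Implicit Arguments.
Unset Strict Implicit.
Unset Printing Implicit Defensive.

Local Open Scope ring_scope.

(** * The exponential of a real matrix *)

(** Matrix spaces are complete and normed; joining the two structures gives
    access to absolutely convergent series of matrices. *)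
HB.instance Definition _ (R : realType) m n := Complete.on 'M[R]_(m, n).

Local Notation mexp_series A := (series (fun k : nat => (k`!%:R)^-1 *: A ^+ k)).

Section MatrixExponential.
Local Open Scope classical_set_scope.
Variable R : realType.

Lemma normr_mx_entry m n (A : 'M[R]_(m, n)) i j : `|A i j| <= `|A|.
Proof.
by rewrite [leRHS]/Num.norm /= mx_normrE; apply/bigmax_geP; right; exists (i, j).
Qed.

(** The norm is the maximum of the absolute values of the entries; it becomes
    submultiplicative only after scaling by the size of the matrix. *)
Lemma normr_mxX n (A : 'M[R]_n) k : `|A ^+ k| <= (n%:R * `|A|) ^+ k.
Proof.
elim: k => [|k IHk].
  rewrite !expr0 [leLHS]/Num.norm /= mx_normrE.
  apply/bigmax_leP; split=> // -[i j] _ /=.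
  by rewrite mxE; case: eqP => _; rewrite ?normr1 ?normr0 // ler01.
rewrite [leLHS]/Num.norm /= mx_normrE; apply/bigmax_leP.
split=> [|[i j] _ /=]; first by rewrite exprn_ge0 // mulr_ge0.
rewrite exprS mxE (le_trans (ler_norm_sum _ _ _)) //.
apply: (@le_trans _ _ (\sum_(l < n) `|A| * (n%:R * `|A|) ^+ k)).
  apply: ler_sum => l _; rewrite normrM ler_pM // ?normr_mx_entry //.
  exact: le_trans (normr_mx_entry _ _ _) IHk.
by rewrite sumr_const card_ord -[leLHS]mulr_natl exprS mulrA.
Qed.

(** The series is dominated by the exponential series of a real number. *)
Lemma is_cvg_mexp n (A : 'M[R]_n) : cvgn (mexp_series A).
Proof.
apply: normed_cvg.
apply: series_le_cvg (is_cvg_series_exp_coeff (n%:R * `|A|)) => [k|k|k].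
- exact: normr_ge0.
- by apply: exp_coeff_ge0; rewrite mulr_ge0.
- rewrite /exp_coeff /= normrZ ger0_norm ?invr_ge0 //.
  by rewrite mulrC ler_wpM2r ?invr_ge0 // normr_mxX.
Qed.

Lemma cvg_mexp_entry n (A : 'M[R]_n) i j :
  (mexp_series A m i j) @[m --> \oo] --> mexp A i j.
Proof.
have cA : mexp_series A m @[m --> \oo] --> mexp A by exact: is_cvg_mexp.
exact: continuous_cvg (@coord_continuous R n n i j (mexp A)) cA.
Qed.

(** The relation holds for the powers of A and B, hence for the partial sums,
    and multiplication by U is continuous. *)
Lemma mexp_intertwine m n (A : 'M[R]_m) (B : 'M[R]_n) (U : 'M[R]_(m, n)) :
  A *m U = U *m B -> mexp A *m U = U *m mexp B.
Proof.
move=> AU.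
have AUX k : A ^+ k *m U = U *m B ^+ k.
  elim: k => [|k IHk]; first by rewrite !expr0 [LHS]mul1mx [RHS]mulmx1.
  have [-> ->] : A ^+ k.+1 = A ^+ k *m A /\ B ^+ k.+1 = B ^+ k *m B.
    by rewrite !exprSr.
  by rewrite -mulmxA AU mulmxA IHk -mulmxA.
have AUS k : mexp_series A k *m U = U *m mexp_series B k.
  rewrite /series /= mulmx_suml mulmx_sumr; apply: eq_bigr => l _.
  by rewrite -scalemxAl AUX scalemxAr.
apply/matrixP => i j.
have cA : (mexp_series A k *m U) i j @[k --> \oo] --> (mexp A *m U) i j.
  rewrite mxE; under eq_fun do rewrite mxE.
  apply: (cvg_big add_continuous) => l _.
  by apply: cvgM; [exact: cvg_mexp_entry|exact: cvg_cst].
have cB : (U *m mexp_series B k) i j @[k --> \oo] --> (U *m mexp B) i j.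
  rewrite mxE; under eq_fun do rewrite mxE.
  apply: (cvg_big add_continuous) => l _.
  by apply: cvgM; [exact: cvg_cst|exact: cvg_mexp_entry].
apply: cvg_unique cA _ => //; apply: cvg_trans cB.
by apply: near_eq_cvg; apply: nearW => k; rewrite AUS.
Qed.

Lemma trmx_mexp n (A : 'M[R]_n) : (mexp A)^T = mexp A^T.
Proof.
apply/matrixP => i j; rewrite mxE.
apply: cvg_unique (@cvg_mexp_entry _ A j i) _ => //.
have -> : (fun m => mexp_series A m j i) = (fun m => mexp_series A^T m i j).
  apply/funext => m; rewrite /series /= !summxE; apply: eq_bigr => k _.
  rewrite !mxE; congr (_ * _).
  have -> : A^T ^+ k = (A ^+ k)^T; last by rewrite mxE.
  elim: k => [|k IHk]; first by rewrite !expr0 [RHS]trmx1.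
  by rewrite exprS exprSr IHk [RHS]trmx_mul.
exact: cvg_mexp_entry.
Qed.

Definition exp_poly (a : R) m : {poly R} := \poly_(k < m) (a ^+ k / k`!%:R).

(** Evaluated at A, the error of the doubling formula for partial sums. *)
Definition double_defect m : {poly R} := exp_poly 1 m ^+ 2 - exp_poly 2 m.

(** Below degree m the coefficients of the two terms agree, by the binomial
    theorem for (1 + 1)^k; from degree m on only the square contributes. *)
Lemma double_defect_coef_ge0 m k : 0 <= (double_defect m)`_k.
Proof.
rewrite /double_defect coefB coefM [(exp_poly 2 m)`_k]coef_poly.
under eq_bigr do rewrite !coef_poly !expr1n.
case: ltnP => km; last first.
  by rewrite subr0; apply: sumr_ge0 => i _; do 2 case: ifP => _;
    rewrite ?mul0r ?mulr0 // mulr_ge0 // divr_ge0.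
rewrite subr_ge0 -[2]/(1 + 1 : R) exprDn mulr_suml; apply: ler_sum => i _.
have ik : (i <= k)%N by rewrite -ltnS.
rewrite (leq_ltn_trans ik km) (leq_ltn_trans (leq_subr i k) km) !expr1n mulr1.
rewrite !mul1r -(bin_fact ik) !natrM.
have C0 : ('C(k, i)%:R : R) != 0 by rewrite pnatr_eq0 -lt0n bin_gt0.
by rewrite -!invfM [X in _ * X <= _]invfM mulVKf.
Qed.

Lemma horner_exp_poly a m x : (exp_poly a m).[x] = series (exp_coeff (a * x)) m.
Proof.
rewrite /exp_poly horner_poly /series /= big_mkord; apply: eq_bigr => k _.
by rewrite /exp_coeff /= exprMn mulrAC.
Qed.

Lemma horner_mx_exp_poly n a m (A : 'M[R]_n.+1) :
  horner_mx A (exp_poly a m) = mexp_series (a *: A) m.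
Proof.
rewrite /exp_poly poly_def raddf_sum /series /= big_mkord.
apply: eq_bigr => k _.
by rewrite linearZ /= rmorphXn /= horner_mx_X exprZn scalerA mulrC.
Qed.

(** Nonnegativity of the coefficients turns the triangle inequality into a
    bound by the value of p itself at a real point. *)
Lemma horner_mx_bound n (p : {poly R}) (A : 'M[R]_n.+1) i j :
  (forall k, 0 <= p`_k) -> `|horner_mx A p i j| <= p.[n.+1%:R * `|A|].
Proof.
move=> p0; rewrite horner_coef -{1}[p]coefK poly_def raddf_sum summxE /=.
apply: le_trans (ler_norm_sum _ _ _) _; apply: ler_sum => k _.
rewrite linearZ /= rmorphXn /= horner_mx_X mxE normrM ger0_norm //.
by rewrite ler_wpM2l // (le_trans (normr_mx_entry _ _ _)) // normr_mxX.
Qed.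

Lemma cvg_double_defect x : (double_defect m).[x] @[m --> \oo] --> (0 : R).
Proof.
have cE (y : R) : series (exp_coeff y) m @[m --> \oo] --> expR y.
  exact: is_cvg_series_exp_coeff.
have -> : 0 = expR (1 * x) * expR (1 * x) - expR (2 * x) :> R.
  by rewrite -expRD mul1r -[x + x]mulr2n mulr_natl subrr.
under eq_fun => m.
  by rewrite /double_defect hornerD hornerN expr2 hornerM !horner_exp_poly over.
by apply: cvgB; [apply: cvgM|]; exact: cE.
Qed.

(** The entries of the defect tend to 0 because the scalar defect does. *)
Lemma mexp_double n (A : 'M[R]_n) : mexp (2 *: A) = mexp A *m mexp A.
Proof.
(* Evaluation of polynomials at a matrix requires a nonzero size. *)
case: n A => [|n] A; first by apply/matrixP => -[].
apply/matrixP => i j.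
apply/eqP; rewrite eq_sym -subr_eq0; apply/eqP.
pose d m : R := horner_mx A (double_defect m) i j.
have d0 : d m @[m --> \oo] --> (0 : R).
  apply: norm_cvg0.
  apply: (@squeeze_cvgr _ _ _ _ (fun=> 0)
            (fun m => (double_defect m).[n.+1%:R * `|A|])).
  - apply: nearW => m; rewrite normr_ge0 /=.
    exact: horner_mx_bound (double_defect_coef_ge0 m).
  - exact: cvg_cst.
  - exact: cvg_double_defect.
apply: cvg_unique d0 => //.
have -> : d = fun m => \sum_l mexp_series A m i l * mexp_series A m l j
                       - mexp_series (2 *: A) m i j.
  apply/funext => m; rewrite /d /double_defect rmorphB /= rmorphXn /= expr2.
  by rewrite !horner_mx_exp_poly scale1r mxE [X in X + _]mxE [X in _ + X]mxE.
rewrite mxE; apply: cvgB; last exact: cvg_mexp_entry.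
by apply: (cvg_big add_continuous) => l _; apply: cvgM; exact: cvg_mexp_entry.
Qed.

(** exp A = B^T B with B = exp (A/2), so its trace is a sum of squares. *)
Lemma trace_mexp_ge0 n (A : 'M[R]_n) : A^T = A -> 0 <= \tr (mexp A).
Proof.
move=> symA; have -> : A = 2 *: (2^-1 *: A).
  by rewrite scalerA divff ?pnatr_eq0 // scale1r.
have symE : (mexp (2^-1 *: A))^T = mexp (2^-1 *: A).
  by rewrite trmx_mexp linearZ /= symA.
rewrite mexp_double -{1}symE.
apply: sumr_ge0 => i _; rewrite mxE; apply: sumr_ge0 => j _.
by rewrite mxE -expr2 sqr_ge0.
Qed.
End MatrixExponential.

(** * Adjacency and degrees in the lift *)

Section LiftLaplacian.
Variables (N : nat) (G : sgraph 'I_N) (S : {set 'I_N}).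

Lemma lift_vertexP (P : lift_vertex N -> Prop) :
  (forall i, P (lo i)) -> P (mid N) -> (forall i, P (hi i)) -> forall u, P u.
Proof.
move=> Plo Pmid Phi u; rewrite -[u]fintype.splitK.
case: (fintype.split u) => [i|w] /=; first exact: Plo.
rewrite -[w]fintype.splitK; case: (fintype.split w) => [c|i] /=.
  by rewrite [c]ord1; exact: Pmid.
exact: Phi.
Qed.

Lemma eq_set2 (V : finType) (u v x y : V) :
  ([set u; v]%SET == [set x; y]%SET)
    = (u == x) && (v == y) || (u == y) && (v == x).
Proof.
apply/eqP/idP => [E|/orP[]/andP[/eqP-> /eqP->] //]; last exact: finset.setUC.
have uP : u \in [set x; y]%SET by rewrite -E set21.
have vP : v \in [set x; y]%SET by rewrite -E set22.
have xP : x \in [set u; v]%SET by rewrite E set21.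
have yP : y \in [set u; v]%SET by rewrite E set22.
move: uP vP xP yP; rewrite !inE.
by case/orP=> /eqP-> /orP[]/eqP->; rewrite !eqxx ?orbT //= !orbb;
  [move=> _ /eqP->|move=> /eqP-> _]; rewrite eqxx.
Qed.

Lemma eq_lo i j : (@lo N i == lo j) = (i == j).
Proof. exact: inj_eq (@lshift_inj _ _) _ _. Qed.

Lemma eq_hi i j : (@hi N i == hi j) = (i == j).
Proof. by rewrite /hi (inj_eq (@rshift_inj _ _)) (inj_eq (@rshift_inj _ _)). Qed.

Lemma lo_mid i : (@lo N i == mid N) = false.
Proof. exact: eq_lrshift. Qed.

Lemma lo_hi i j : (@lo N i == hi j) = false.
Proof. exact: eq_lrshift. Qed.

Lemma mid_hi i : (mid N == @hi N i) = false.
Proof. by rewrite /mid /hi (inj_eq (@rshift_inj _ _)) eq_lrshift. Qed.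

Lemma mid_lo i : (mid N == @lo N i) = false.
Proof. by rewrite eq_sym lo_mid. Qed.

Lemma hi_lo i j : (@hi N i == lo j) = false.
Proof. by rewrite eq_sym lo_hi. Qed.

Lemma hi_mid i : (@hi N i == mid N) = false.
Proof. by rewrite eq_sym mid_hi. Qed.

Definition vertex_eqE :=
  (eq_lo, eq_hi, lo_mid, lo_hi, mid_hi, mid_lo, hi_lo, hi_mid, eqxx).

(** Edges of the lift are given as equalities of unordered pairs; this lists
    the possible orientations. *)
Let lift_adjE u v : acikmese_lift G S u v =
  [exists i : 'I_N, exists j : 'I_N, adj G i j &&
     ([&& u == lo i & v == lo j] || [&& u == hi i & v == hi j])]
  || [exists i in S, [|| [&& u == lo i & v == mid N],
       [&& u == mid N & v == lo i], [&& u == mid N & v == hi i]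
       | [&& u == hi i & v == mid N]]].
Proof.
congr (_ || _).
  apply/existsP/existsP => -[i /existsP[j /andP[Gij uv]]].
    have Gji : adj G j i by rewrite adj_sym.
    move: uv; rewrite !eq_set2 => /orP[]/orP[] uv;
      [exists i|exists j|exists i|exists j]; apply/existsP;
      [exists j|exists i|exists j|exists i]; rewrite ?Gij ?Gji /=;
      by rewrite ?uv ?orbT // andbC uv ?orbT.
  exists i; apply/existsP; exists j; rewrite Gij /= !eq_set2.
  by case/orP: uv => ->; rewrite ?orbT.
by apply: eq_existsb => i; rewrite !eq_set2 -!orbA.
Qed.

Lemma lift_adj_lo_lo i j : acikmese_lift G S (lo i) (lo j) = adj G i j.
Proof.
rewrite lift_adjE; apply/orP/idP => [[]|Gij].
- case/existsP => k /existsP[l /andP[Gkl]].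
  by rewrite !vertex_eqE orbF => /andP[/eqP-> /eqP->].
- by case/existsP => k; rewrite !vertex_eqE !(andbF, orbF).
- left; apply/existsP; exists i; apply/existsP; exists j.
  by rewrite Gij !vertex_eqE.
Qed.

Lemma lift_adj_hi_hi i j : acikmese_lift G S (hi i) (hi j) = adj G i j.
Proof.
rewrite lift_adjE; apply/orP/idP => [[]|Gij].
- case/existsP => k /existsP[l /andP[Gkl]].
  by rewrite !vertex_eqE /= => /andP[/eqP-> /eqP->].
- by case/existsP => k; rewrite !vertex_eqE !(andbF, orbF).
- left; apply/existsP; exists i; apply/existsP; exists j.
  by rewrite Gij !vertex_eqE orbT.
Qed.

Lemma lift_adj_lo_hi i j : acikmese_lift G S (lo i) (hi j) = false.
Proof.
rewrite lift_adjE; apply/orP => -[].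
- by case/existsP => k /existsP[l /andP[_]]; rewrite !vertex_eqE !(andbF, orbF).
- by case/existsP => k; rewrite !vertex_eqE !(andbF, orbF).
Qed.

Lemma lift_adj_mid_mid : acikmese_lift G S (mid N) (mid N) = false.
Proof. exact: adj_irr. Qed.

Lemma lift_adj_lo_mid i : acikmese_lift G S (lo i) (mid N) = (i \in S).
Proof.
rewrite lift_adjE; apply/orP/idP => [[]|Si].
- by case/existsP => k /existsP[l /andP[_]]; rewrite !vertex_eqE !(andbF, orbF).
- by case/existsP => k; rewrite !vertex_eqE !orbF andbT => /andP[Sk /eqP->].
- by right; apply/existsP; exists i; rewrite Si !vertex_eqE.
Qed.

Lemma lift_adj_hi_mid i : acikmese_lift G S (hi i) (mid N) = (i \in S).
Proof.
rewrite lift_adjE; apply/orP/idP => [[]|Si].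
- by case/existsP => k /existsP[l /andP[_]]; rewrite !vertex_eqE !(andbF, orbF).
- by case/existsP => k; rewrite !vertex_eqE /= andbT => /andP[Sk /eqP->].
- by right; apply/existsP; exists i; rewrite Si !vertex_eqE.
Qed.

Definition lift_adj_vertexE := (lift_adj_lo_lo, lift_adj_hi_hi, lift_adj_lo_hi,
  lift_adj_mid_mid, lift_adj_lo_mid, lift_adj_hi_mid).

Lemma degree_sum (V : finType) (H : sgraph V) v :
  degree H v = (\sum_w adj H v w)%N.
Proof.
rewrite /degree -sum1_card big_mkcond; apply: eq_bigr => w _.
by rewrite inE; case: (adj _ _ _).
Qed.

Lemma sum_vertex (F : lift_vertex N -> nat) :
  (\sum_u F u = \sum_i F (lo i) + F (mid N) + \sum_i F (hi i))%N.
Proof. by rewrite big_split_ord /= big_split_ord /= big_ord1 addnA. Qed.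

Lemma degree_lo i : degree (acikmese_lift G S) (lo i) = (degree G i + (i \in S))%N.
Proof.
rewrite !degree_sum sum_vertex [X in (_ + X)%N]big1 ?addn0 => [|j _].
  by rewrite lift_adj_lo_mid; under eq_bigr do rewrite lift_adj_lo_lo.
by rewrite lift_adj_lo_hi.
Qed.

Lemma degree_hi i : degree (acikmese_lift G S) (hi i) = (degree G i + (i \in S))%N.
Proof.
rewrite !degree_sum sum_vertex [X in (X + _ + _)%N]big1 => [|j _]; last first.
  by rewrite adj_sym lift_adj_lo_hi.
by rewrite add0n lift_adj_hi_mid addnC; under eq_bigr do rewrite lift_adj_hi_hi.
Qed.

Lemma degree_mid : degree (acikmese_lift G S) (mid N) = (2 * #|S|)%N.
Proof.
rewrite degree_sum sum_vertex lift_adj_mid_mid addn0 mul2n -addnn.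
have SE : (\sum_i (i \in S) = #|S|)%N.
  by rewrite -sum1_card [RHS]big_mkcond; apply: eq_bigr => i _; case: (i \in S).
congr (_ + _)%N; rewrite -[RHS]SE; apply: eq_bigr => i _.
  by rewrite adj_sym lift_adj_lo_mid.
by rewrite adj_sym lift_adj_hi_mid.
Qed.

(** * The Laplacian on even and odd vectors *)

Variable R : realType.
Notation L := (loop_laplacian R G S).
Notation s := (loop_vec R S).

Lemma laplacianE n (H : sgraph 'I_n) i j :
  laplacian R H i j = (degree H i)%:R *+ (i == j) - (adj H i j)%:R.
Proof. by rewrite !mxE. Qed.

Lemma loop_laplacianE i j :
  L i j = (degree G i + (i \in S))%:R *+ (i == j) - (adj G i j)%:R.
Proof. by rewrite mxE laplacianE !mxE addrAC natrD mulrnDl. Qed.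

Lemma laplacian_lift_block : laplacian R (acikmese_lift G S) =
  block_mx L                (row_mx (- s) 0)
           (col_mx (- s^T) 0) (block_mx (2 * #|S|%:R)%:M (- s^T) (- s) L).
Proof.
apply/matrixP; apply: lift_vertexP => [i||i]; apply: lift_vertexP => [j||j];
  rewrite laplacianE ?degree_lo ?degree_mid ?degree_hi
    ?[adj _ (mid N) (lo _)]adj_sym ?[adj _ (mid N) (hi _)]adj_sym
    ?[adj _ (hi _) (lo _)]adj_sym !lift_adj_vertexE !vertex_eqE /lo /mid /hi
    ?(block_mxEul, block_mxEur, block_mxEdl, block_mxEdr)
    ?(row_mxEl, row_mxEr, col_mxEu, col_mxEd)
    ?(block_mxEul, block_mxEur, block_mxEdl, block_mxEdr)
    ?loop_laplacianE ?mxE ?sub0r ?subr0 ?oppr0 //.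
by rewrite natrM.
Qed.

Lemma involution_block : involution_mx R N =
  block_mx 0 (row_mx 0 1%:M) (col_mx 0 1%:M) (block_mx 1%:M 0 0 0).
Proof.
apply/matrixP; apply: lift_vertexP => [i||i]; apply: lift_vertexP => [j||j];
  rewrite mxE mxE permE ?swap_lo ?swap_mid ?swap_hi !vertex_eqE /lo /mid /hi
    ?(block_mxEul, block_mxEur, block_mxEdl, block_mxEdr)
    ?(row_mxEl, row_mxEr, col_mxEu, col_mxEd)
    ?(block_mxEul, block_mxEur, block_mxEdl, block_mxEdr) ?mxE //.
Qed.

Let r : R := (Num.sqrt 2)^-1.

(** The columns are the unit vector of the middle vertex followed by
    (e_i + e_{i'}) / sqrt 2, the order of coordinates used by [Msym]. *)
Definition even_basis : 'M[R]_(N + (1 + N), 1 + N) :=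
  block_mx 0 r%:M (col_mx 1%:M 0) (col_mx 0 r%:M).

(** The columns are (e_i - e_{i'}) / sqrt 2. *)
Definition odd_basis : 'M[R]_(N + (1 + N), N) :=
  col_mx r%:M (col_mx 0 (- r%:M)).

Notation U := even_basis.
Notation W := odd_basis.

Let rs2 : r * Num.sqrt 2 = 1.
Proof. by rewrite mulVf // sqrtr_eq0 -ltNge. Qed.

Let rr : r * r = 2^-1.
Proof. by rewrite -invfM -expr2 sqr_sqrtr. Qed.

Let rD : r + r = Num.sqrt 2.
Proof.
rewrite -[RHS]mulr1 -{2}rs2 [r * _]mulrC mulrA -expr2 sqr_sqrtr //.
by rewrite mulr_natl mulr2n.
Qed.

Let rrD : r * r + r * r = 1.
Proof. by rewrite rr -[2^-1]mul1r -splitr. Qed.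

Lemma involution_even : involution_mx R N *m U = U.
Proof.
rewrite involution_block /U mulmx_block !mul0mx !add0r.
rewrite !mul_row_col !mul_block_col !mul_col_mx !mul0mx ?mulmx0 !mul1mx.
by rewrite !add_col_mx !addr0 !add0r.
Qed.

Lemma involution_odd : involution_mx R N *m W = - W.
Proof.
rewrite involution_block /W mul_block_col !mul0mx !add0r.
rewrite !mul_row_col !mul_block_col !mul_col_mx !mul0mx ?mulmx0 !mul1mx.
by rewrite !add_col_mx !addr0 !add0r !opp_col_mx opprK oppr0.
Qed.

(** The factors sqrt 2 in [Msym] come from normalizing e_i + e_{i'}: the middle
    vertex sees each pair {i, i'} twice, with weight 1 / sqrt 2. *)
Lemma laplacian_even :
  laplacian R (acikmese_lift G S) *m U = U *m Msym R G S.
Proof.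
rewrite laplacian_lift_block /U /Msym !mulmx_block.
rewrite !mul_row_col !mul_block_col !mul_col_mx !mul0mx ?mulmx0 !mul1mx.
rewrite !mulmx1 !addr0 ?add0r !mul_scalar_mx !mul_mx_scalar !scalerA !mulrN !rs2.
rewrite !add_col_mx !addr0 !add0r !scaleN1r scalerN -opprD -scalerDl rD scaleNr.
by [].
Qed.

(** On odd vectors the contributions of i and i' at the middle vertex cancel,
    so a loop of the self-loop graph behaves as an edge to a grounded vertex. *)
Lemma laplacian_odd :
  laplacian R (acikmese_lift G S) *m W = W *m L.
Proof.
rewrite laplacian_lift_block /W mul_block_col.
rewrite !mul_row_col !mul_block_col !mul_col_mx !mul0mx ?mulmx0.
rewrite !mulmxN !mulNmx !mul_scalar_mx !mul_mx_scalar.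
by rewrite !add_col_mx !addr0 !add0r subrr.
Qed.

Lemma even_basis_orthonormal : U^T *m U = 1%:M.
Proof.
rewrite /U tr_block_mx !tr_col_mx !trmx0 !tr_scalar_mx mulmx_block.
rewrite !mul_row_col ?mulmx0 ?mul0mx ?mulmx1 ?addr0 ?add0r -!scalar_mxM -!raddfD /=.
by rewrite rrD -scalar_mx_block.
Qed.

Lemma odd_basis_orthonormal : W^T *m W = 1%:M.
Proof.
rewrite /W !tr_col_mx !linearN /= !trmx0 !tr_scalar_mx !mul_row_col.
by rewrite mul0mx add0r mulNmx mulmxN opprK -scalar_mxM -raddfD /= rrD.
Qed.

Lemma even_odd_complete : U *m U^T + W *m W^T = 1%:M.
Proof.
rewrite /U /W tr_block_mx !tr_col_mx !linearN /= !trmx0 !tr_scalar_mx mulmx_block.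
rewrite !mul_col_row !mul_col_mx !mul_mx_row.
rewrite ?mul0mx ?mulmx0 !mulmx1 !mulNmx !mulmxN ?mulmx0 ?oppr0 !opprK -!scalar_mxM.
rewrite !add_block_mx !add_row_mx !add_col_mx !addr0 !add0r.
rewrite !subrr -!raddfD /= rrD row_mx0 col_mx0 -scalar_mx_block.
by rewrite -scalar_mx_block.
Qed.

(** Insert U U^T + W W^T = 1 and use the cyclicity of the trace. *)
Lemma trace_even_odd (E : 'M[R]_(N + (1 + N))) :
  \tr E = \tr (U^T *m E *m U) + \tr (W^T *m E *m W).
Proof.
rewrite -{1}[E]mulmx1 -even_odd_complete mulmxDr linearD /=.
by rewrite !mulmxA [in LHS]mxtrace_mulC [X in _ + X]mxtrace_mulC !mulmxA.
Qed.

(** * Heat characters *)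

Lemma laplacian_sym n (H : sgraph 'I_n) : (laplacian R H)^T = laplacian R H.
Proof.
apply/matrixP => i j; rewrite mxE !laplacianE adj_sym eq_sym.
by case: eqP => [->|].
Qed.

Lemma loop_laplacian_sym : L^T = L.
Proof. by rewrite /loop_laplacian linearD /= laplacian_sym tr_diag_mx. Qed.

Lemma Msym_sym : (Msym R G S)^T = Msym R G S.
Proof.
by rewrite /Msym tr_block_mx tr_scalar_mx !linearZ /= trmxK loop_laplacian_sym.
Qed.

Variable t : R.
Let E := mexp (- t *: laplacian R (acikmese_lift G S)).

Lemma heat_even : U^T *m E *m U = mexp (- t *: Msym R G S).
Proof.
rewrite -mulmxA (@mexp_intertwine _ _ _ _ (- t *: Msym R G S)).
  by rewrite mulmxA even_basis_orthonormal mul1mx.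
by rewrite -scalemxAl laplacian_even scalemxAr.
Qed.

Lemma heat_odd : W^T *m E *m W = mexp (- t *: L).
Proof.
rewrite -mulmxA (@mexp_intertwine _ _ _ _ (- t *: L)).
  by rewrite mulmxA odd_basis_orthonormal mul1mx.
by rewrite -scalemxAl laplacian_odd scalemxAr.
Qed.

Lemma heat_char_id : heat_char G S t 1%g =
  \tr (mexp (- t *: Msym R G S)) + \tr (mexp (- t *: L)).
Proof.
by rewrite /heat_char rho1 mulmx1 trace_even_odd heat_even heat_odd.
Qed.

Lemma heat_char_gen : heat_char G S t gen =
  \tr (mexp (- t *: Msym R G S)) - \tr (mexp (- t *: L)).
Proof.
rewrite /heat_char rho_gen trace_even_odd !mulmxA.
rewrite -(mulmxA _ _ U) -(mulmxA _ _ W).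
by rewrite involution_even involution_odd mulmxN linearN /= heat_even heat_odd.
Qed.
End LiftLaplacian.

Theorem theorem5p2 (R : realType) (N : nat) (G : sgraph 'I_N)
    (S : {set 'I_N}) (hS : (1 <= #|S|)%N) (t : R) (ht : 0 < t) :
  let chi := heat_char G S t in
  let trM := \tr (mexp (- t *: Msym R G S)) in
  let trL := \tr (mexp (- t *: loop_laplacian R G S)) in
  [/\ chi 1%g = trM + trL /\ chi gen = trM - trL,
      trM = (chi 1%g + chi gen) / 2 /\ trL = (chi 1%g - chi gen) / 2,
      - chi 1%g <= chi gen /\ chi gen <= chi 1%g
    & 0 <= chi 1%g + chi gen /\ 0 <= chi 1%g - chi gen].
Proof.
move=> chi trM trL.
have chi1 : chi 1%g = trM + trL := heat_char_id G S t.
have chig : chi gen = trM - trL := heat_char_gen G S t.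
have trM0 : 0 <= trM.
  by apply: trace_mexp_ge0; rewrite linearZ /= Msym_sym.
have trL0 : 0 <= trL.
  by apply: trace_mexp_ge0; rewrite linearZ /= loop_laplacian_sym.
by rewrite chi1 chig; split; split=> //; lra.
Qed.
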